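(* Let $\mathbb{D}=(D,\mathcal{X},I)$ be a linear space such that $|D|=q^2$ for some integer $q>1$, $|\mathcal{X}_p|\le q+1$ for each $p\in D$, and $|D_X|\le q+1$ for each $X\in\mathcal{X}$. If there exists a point $u\in D$ with $|\mathcal{X}_u|\le q$, then $\mathbb{D}$ is obtained from a projective plane $\mathbb{P}=(P,\mathcal{L})$ of order $q$ by deleting some line $W$ from $\mathcal{L}$ and deleting the point set $(P_W\setminus\{u\})\cup\{v\}$ from $P$, where $u$ is some point on $W$ and $v$ is some point in $P\setminus P_W$ (the lines of $\mathbb{D}$ being the lines of $\mathbb{P}$ other than $W$, with induced incidence). In this case $|\mathcal{X}_u|=q$, and $|\mathcal{X}_p|=q+1$ for each $p\in D\setminus\{u\}$. Moreover, the line of $\mathbb{P}$ joining $u$ and $v$ has $q$ points in $D$, every other line through $u$ has $q+1$ points in $D$, every other line of $\mathbb{P}$ through $v$ has $q-1$ points in $D$, and each line of $\mathbb{D}$ passing through neither $u$ nor $v$ has $q$ points in $D$.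
   Context: A linear space is an incidence geometry $(D,\mathcal{X},I)$ with point set $D$, line set $\mathcal{X}$ and incidence relation $I\subseteq D\times\mathcal{X}$ such that any two distinct points are incident with exactly one common line, and each line is incident with at least two points. For $p\in D$, $\mathcal{X}_p$ is the set of lines incident with $p$; for a line $X$, $D_X$ is the set of points of $D$ incident with $X$; for a projective plane $\mathbb{P}=(P,\mathcal{L})$ and $W\in\mathcal{L}$, $P_W$ is the set of points of $\mathbb{P}$ on $W$.
   Formalization: The claim is proved for q > 2 instead of q > 1: for q = 2 it is false, since the linear space on four points with lines {u,b,c}, {u,a}, {b,a}, {c,a} meets all hypotheses but b lies on only two lines. *)

(* Defs.v *)
From mathcomp Require Import all_boot.

Set Implicit Arguments.
Unset Strict Implicit.
Unset Printing Implicit Defensive.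

(* Lines form a type of their own, as in the triple (D, X, I); they are not
   assumed to be sets of points.  In a linear space with finitely many points
   the line set is finite too, since a line is determined by two of its points;
   hence [finType] for both sorts. *)
Record geometry := Geometry {
  point : finType;
  line : finType;
  inc : point -> line -> bool
}.

Definition lines_of (G : geometry) (p : point G) : {set line G} :=
  [set l | inc p l].

Definition points_of (G : geometry) (l : line G) : {set point G} :=
  [set p | inc p l].

Definition linear_space (G : geometry) : Prop :=
  (forall p1 p2 : point G, p1 != p2 ->
     exists! l : line G, inc p1 l /\ inc p2 l) /\
  (forall l : line G, 2 <= #|points_of l|).

Definition projective_plane (G : geometry) : Prop :=
  [/\ forall p1 p2 : point G, p1 != p2 ->
        exists! l : line G, inc p1 l /\ inc p2 l,
      forall l1 l2 : line G, l1 != l2 ->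
        exists! p : point G, inc p l1 /\ inc p l2
    & exists Q : {set point G},
        #|Q| = 4 /\ forall l : line G, #|Q :&: points_of l| <= 2].

Definition projective_plane_of_order (G : geometry) (q : nat) : Prop :=
  projective_plane G /\ forall l : line G, #|points_of l| = q.+1.

Definition delete (G : geometry) (A : {set point G}) (B : {set line G}) :
    geometry :=
  @Geometry {p : point G | p \notin A} {l : line G | l \notin B}
    (fun p l => inc (val p) (val l)).

Definition isomorphism (G H : geometry)
    (f : point G -> point H) (g : line G -> line H) : Prop :=
  [/\ bijective f, bijective g
    & forall (p : point G) (l : line G), inc (f p) (g l) = inc p l].

Definition plane_deletion (P : geometry) (W : line P) (u v : point P) :
    geometry :=
  delete (v |: (points_of W :\ u)) [set W].

(* Main.v *)
(* Counting the points other than [u] along the lines through [u] gives q lines,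
   one of them, [U], with q points and the others with q+1.  For p off a line L,
   exactly |L| of the lines through p meet L; applied to the long lines through
   [u] this yields q+1 lines at every other point and shows that all lines meet
   every long line.  A line X not through [u] hence has q points if it meets [U]
   and q-1 points if it does not.  Removing [u] and adding a point v on [U] and
   on all lines disjoint from [U] therefore gives an affine plane of order q, in
   which the lines through [u] form a parallel class.  Its projective completion
   is the plane sought, with W the line at infinity and [u] the point at infinity
   of that class. *)
Require Import Defs.
From mathcomp Require Import all_boot zify.

Set Implicit Arguments.
Unset Strict Implicit.
Unset Printing Implicit Defensive.

(** * Counting lines through a point *)

Definition unique_join (G : geometry) : Prop :=
  forall p1 p2 : point G, p1 != p2 ->
    exists! l : line G, inc p1 l /\ inc p2 l.

Definition meet (G : geometry) (X Y : line G) : bool :=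
  [exists p, inc p X && inc p Y].

Section UniqueJoin.

Variables (G : geometry) (joinG : unique_join G).
Implicit Types (p r : point G) (X Y Z : line G) (A : {set point G}).

Lemma eq_join p r X Y : p != r ->
  inc p X -> inc r X -> inc p Y -> inc r Y -> X = Y.
Proof.
move=> /joinG[Z [_ uniqZ]] pX rX pY rY.
by rewrite -(uniqZ X) // -(uniqZ Y).
Qed.

Lemma eq_meet p r X Y : X != Y ->
  inc p X -> inc p Y -> inc r X -> inc r Y -> p = r.
Proof.
move=> neqXY pX pY rX rY; apply/eqP/negPn/negP => neqpr.
by case/eqP: neqXY; apply: (eq_join neqpr).
Qed.

Lemma meetP X Y : reflect (exists p, inc p X /\ inc p Y) (meet X Y).
Proof.
apply: (iffP existsP) => [[p /andP[pX pY]]|[p [pX pY]]]; exists p => //.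
by rewrite pX.
Qed.

Lemma meetC X Y : meet X Y = meet Y X.
Proof. by apply: eq_existsb => p; rewrite andbC. Qed.

(** Double counting: each point of [A] differs from [p], so it lies on exactly one line through
    [p]. *)
Lemma sum_card_lines p A : p \notin A ->
  \sum_(X in lines_of p) #|points_of X :&: A| = #|A|.
Proof.
move=> pA.
transitivity (\sum_(X in lines_of p) \sum_(r in A) inc r X).
  apply: eq_bigr => X _.
  rewrite -sum1_card (eq_bigl (fun r => (r \in A) && inc r X)) => [|r].
    by rewrite big_mkcondr; apply: eq_bigr => r _; case: (inc r X).
  by rewrite !inE andbC.
rewrite exchange_big -sum1_card; apply: eq_bigr => r rA.
have /joinG[Z [[pZ rZ] uniqZ]] : p != r by apply: contraNneq pA => ->.
rewrite (bigD1 Z) ?inE //= rZ big1 // => X; rewrite inE => /andP[pX neqXZ].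
case rX: (inc r X) => //.
by rewrite (uniqZ X) ?eqxx in neqXZ.
Qed.

(** The previous sum with the points of [X] as [A]: a line through [p] is not [X], so it contributes
    1 or 0. *)
Lemma card_meeting p X : ~~ inc p X ->
  #|[set Y in lines_of p | meet Y X]| = #|points_of X|.
Proof.
move=> pX; rewrite -(@sum_card_lines p (points_of X)) ?inE //.
rewrite -sum1_card big_mkcond [RHS]big_mkcond; apply: eq_bigr => Y _ /=.
rewrite !inE; case pY: (inc p Y) => //=.
have neqYX : Y != X by apply: contraNneq pX => <-.
case: ifPn => [/meetP[r [rY rX]]|].
  rewrite (_ : _ :&: _ = [set r]) ?cards1 //; apply/setP => s; rewrite !inE.
  apply/andP/eqP => [[sY sX]|->//]; exact: (eq_meet neqYX).
move/existsPn => disj; symmetry; apply: eq_card0 => r.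
by rewrite !inE; apply/negbTE/disj.
Qed.

Lemma card_missing p X : ~~ inc p X ->
  #|[set Y in lines_of p | ~~ meet Y X]| = #|lines_of p| - #|points_of X|.
Proof.
move=> /card_meeting <-.
rewrite -(cardsID [set Y | meet Y X] (lines_of p)).
rewrite (_ : lines_of p :&: _ = [set Y in lines_of p | meet Y X]) ?addKn.
  by apply: eq_card => Y; rewrite !inE andbC.
by apply/setP => Y; rewrite !inE.
Qed.

Lemma sum_card_lines_pred p :
  \sum_(X in lines_of p) #|points_of X|.-1 = #|point G|.-1.
Proof.
rewrite -(cardsC1 p) -(@sum_card_lines p [set~ p]) ?inE ?eqxx //.
apply: eq_bigr => X; rewrite inE => pX.
by rewrite (cardsD1 p (points_of X)) inE pX /= setDE.
Qed.

End UniqueJoin.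

(** * Affine planes and their projective completion *)

Definition parallel (G : geometry) (X Y : line G) : bool :=
  (X == Y) || ~~ meet X Y.

Definition parallel_class (G : geometry) (X : line G) : {set line G} :=
  [set Y | parallel X Y].

Definition ideal_point (G : geometry) : finType :=
  {c : {set line G} | c \in [set parallel_class X | X : line G]}.

Definition direction (G : geometry) (X : line G) : ideal_point G :=
  exist _ (parallel_class X) (imset_f (@parallel_class G) isT).

(* [None] is the line at infinity. *)
Definition completion (G : geometry) : geometry :=
  @Geometry (point G + ideal_point G)%type (option (line G))
    (fun p L => match p, L with
     | inl p, Some X => inc p X
     | inl _, None => false
     | inr c, Some X => direction X == c
     | inr _, None => true
     end).

Section AffinePlane.

Variables (G : geometry) (q : nat).
Hypotheses (joinG : unique_join G) (q_gt1 : 1 < q).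
Hypotheses (card_point : #|point G| = q ^ 2).
Hypotheses (card_line : forall X : line G, #|points_of X| = q).
Implicit Types (p r : point G) (X Y Z : line G) (c : ideal_point G).

(** The [q ^ 2 - 1] points other than [p] are shared out, [q - 1] to each line through [p]. *)
Lemma card_lines_affine p : #|lines_of p| = q.+1.
Proof.
have := sum_card_lines_pred joinG p.
rewrite (eq_bigr (fun=> q.-1)) => [|X _]; last by rewrite card_line.
rewrite sum_nat_const card_point; nia.
Qed.

Lemma parallelC X Y : parallel X Y = parallel Y X.
Proof. by rewrite /parallel eq_sym meetC. Qed.

Lemma parallel_eq p X Y : parallel X Y -> inc p X -> inc p Y -> X = Y.
Proof.
by move=> /orP[/eqP//|/existsPn/(_ p) + pX pY]; rewrite pX pY.
Qed.

(** If [p] is off [X], then [q] of the [q.+1] lines through [p] meet [X], which leaves a single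
    one. *)
Lemma playfair p X : exists! Y, inc p Y /\ parallel Y X.
Proof.
case pX: (inc p X).
  exists X; split=> [|Y [pY parYX]]; first by rewrite /parallel eqxx.
  by rewrite (parallel_eq parYX pY pX).
have := card_missing joinG (negbT pX).
rewrite card_lines_affine card_line subSnn => /eqP/cards1P[Y missY].
have missE Z : (Z == Y) = inc p Z && ~~ meet Z X.
  by have /setP/(_ Z) := missY; rewrite !inE => ->.
have := missE Y; rewrite eqxx => /esym/andP[pY YX].
exists Y; split=> [|Z [pZ]]; first by rewrite /parallel YX orbT.
case/orP=> [/eqP eqZX|ZX]; first by rewrite -eqZX pZ in pX.
by symmetry; apply/eqP; rewrite missE pZ.
Qed.

(** If [X] and [Z] share a point, both are the unique parallel to [Y] through it. *)
Lemma parallel_trans X Y Z : parallel X Y -> parallel Y Z -> parallel X Z.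
Proof.
move=> parXY parYZ; rewrite /parallel orbC -implybE.
apply/implyP => /meetP[p [pX pZ]].
have [W [_ uniqW]] := playfair p Y.
by rewrite -(uniqW X) // -(uniqW Z) // parallelC.
Qed.

Lemma eq_direction X Y : (direction X == direction Y) = parallel X Y.
Proof.
apply/eqP/idP => [[/setP/(_ Y)]|parXY].
  by rewrite !inE /(parallel Y) eqxx.
apply/val_inj/setP => Z; rewrite !inE.
apply/idP/idP; apply: parallel_trans => //; by rewrite parallelC.
Qed.

Lemma directionP c : exists X, c = direction X.
Proof.
have /imsetP[X _ cX] := valP c.
by exists X; apply: val_inj.
Qed.

Lemma direction_through p c : exists! X, inc p X /\ direction X = c.
Proof.
have [X ->] := directionP c; have [Y [[pY parYX] uniqY]] := playfair p X.
exists Y; split=> [|Z [pZ /eqP]].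
  by split=> //; apply/eqP; rewrite eq_direction.
by rewrite eq_direction => parZX; apply: uniqY.
Qed.

Lemma direction_inj p X Y : inc p X -> inc p Y ->
  direction X = direction Y -> X = Y.
Proof.
move=> pX pY /eqP; rewrite eq_direction => parXY.
exact: (parallel_eq parXY pX).
Qed.

(** Through any fixed point there is exactly one line in each direction. *)
Lemma card_ideal_point : #|ideal_point G| = q.+1.
Proof.
have /card_gt0P[p _] : 0 < #|point G| by rewrite card_point expn_gt0; lia.
have dir_inj : {in lines_of p &, injective (@direction G)}.
  by move=> X Y; rewrite !inE; apply: direction_inj.
rewrite -cardsT -(card_lines_affine p) -(card_in_imset dir_inj).
congr #|pred_of_set _|; apply/setP => c; rewrite inE; symmetry; apply/imsetP.
have [X [[pX <-] _]] := direction_through p c.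
by exists X; rewrite ?inE.
Qed.

Lemma card_points_completion (L : line (completion G)) : #|points_of L| = q.+1.
Proof.
have -> : #|points_of L| =
    #|[set p | inc (inl p : point (completion G)) L]| +
    #|[set c | inc (inr c : point (completion G)) L]|.
  by rewrite -!sum1dep_card big_sumType.
case: L => [X|].
  rewrite -addn1 -(card_line X); congr (_ + _).
  by rewrite -(cards1 (direction X)); apply: eq_card => c; rewrite !inE eq_sym.
rewrite eq_card0 => [|p]; last by rewrite !inE.
by rewrite add0n -card_ideal_point -cardsT; apply: eq_card => c; rewrite !inE.
Qed.

Lemma completion_join : unique_join (completion G).
Proof.
move=> [p|c] [r|d] neq.
- have /joinG[X [[pX rX] uniqX]] : p != r by apply: contraNneq neq => ->.
  by exists (Some X); split=> // -[Y|] [] //= pY rY; rewrite (uniqX Y).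
- have [X [[pX /eqP dX] uniqX]] := direction_through p d.
  by exists (Some X); split=> // -[Y|] [] //= pY /eqP dY; rewrite (uniqX Y).
- have [X [[pX /eqP dX] uniqX]] := direction_through r c.
  by exists (Some X); split=> // -[Y|] [] //= /eqP dY pY; rewrite (uniqX Y).
exists None; split=> // -[Y|] [] //= /eqP Yc /eqP Yd.
by rewrite -Yc -Yd eqxx in neq.
Qed.

Lemma completion_meet (L M : line (completion G)) : L != M ->
  exists! x, inc x L /\ inc x M.
Proof.
move=> neq.
(* Uniqueness is already a consequence of unique joins; disjoint affine lines meet in their common
   direction. *)
suff [x [xL xM]] : exists x, inc x L /\ inc x M.
  by exists x; split=> // y [yL yM]; apply: (eq_meet completion_join neq).
case: L M neq => [X|] [Y|] neq //; last 2 first.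
- by exists (inr (direction X)); rewrite /= eqxx.
- by exists (inr (direction Y)); rewrite /= eqxx.
have [/meetP[p [pX pY]]|XY] := boolP (meet X Y); first by exists (inl p).
exists (inr (direction X)); rewrite /= eqxx eq_direction parallelC.
by rewrite /parallel XY orbT.
Qed.

(* Two points of an affine line, and the directions of two other lines through
   the first of them. *)
Lemma completion_quadrangle : exists Q : {set point (completion G)},
  #|Q| = 4 /\ forall L : line (completion G), #|Q :&: points_of L| <= 2.
Proof.
have /card_gt0P[p _] : 0 < #|point G| by rewrite card_point expn_gt0; lia.
have /card_gt2P[X [Y [Z [[pX pY pZ] [XY YZ ZX]]]]] : 2 < #|lines_of p|.
  by rewrite card_lines_affine.
rewrite !inE in pX pY pZ.
have /card_gt0P[r] : 0 < #|points_of X :\ p|.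
  by have := cardsD1 p (points_of X); rewrite card_line inE pX; lia.
rewrite !inE => /andP[neqrp rX].
have pr1 W : inc p W -> inc r W -> W = X.
  by move=> pW rW; apply: (eq_join joinG neqrp).
have dirYZ : direction Y != direction Z.
  by apply: contraNneq YZ => /(direction_inj pY pZ) ->.
have dirYX : direction Y != direction X.
  by apply: contraNneq XY => /(direction_inj pY pX) ->.
have dirZX : direction Z != direction X.
  by apply: contraNneq ZX => /(direction_inj pZ pX) ->.
pose s : seq (point (completion G)) :=
  [:: inl p; inl r; inr (direction Y); inr (direction Z)].
have uniq_s : uniq s.
  rewrite /= !inE !negb_or (inj_eq inl_inj) (inj_eq inr_inj).
  by rewrite eq_sym neqrp dirYZ.
exists [set x in s]; split; first by rewrite cardsE (card_uniqP uniq_s).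
move=> L.
have -> : #|[set x in s] :&: points_of L| = count (fun x => inc x L) s.
  rewrite -size_filter -(card_uniqP (filter_uniq _ uniq_s)).
  by apply: eq_card => x; rewrite mem_filter !inE andbC.
case: L => [W|] //=.
have dirW :
    (direction W == direction Y) && (direction W == direction Z) = false.
  by apply/negbTE/negP => /andP[/eqP-> YZ']; rewrite YZ' in dirYZ.
(* If [W] contains both [p] and [r], it is [X] and has neither chosen direction. Otherwise it has at
   most one of [p], [r] and, by [dirW], at most one of the directions. *)
case pW: (inc p W); case rW: (inc r W); first by
    rewrite (pr1 W) // !(eq_sym (direction X)) (negbTE dirYX) (negbTE dirZX).
all: by move: dirW; case: eqP; case: eqP.
Qed.

Lemma completion_projective : projective_plane_of_order (completion G) q.
Proof.
split; last exact: card_points_completion.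
by split; [exact: completion_join | exact: completion_meet
          | exact: completion_quadrangle].
Qed.

End AffinePlane.

(* The point [u] is removed and a point on [U] and on all lines disjoint from
   [U] is added under the same name, so both sorts stay the same. *)
Definition exchange (G : geometry) (u : point G) (U : line G) : geometry :=
  @Geometry (point G) (line G)
    (fun p X => if p == u then parallel X U else inc p X).

(** * Numbers of points and lines in the given linear space *)

Lemma exists_short_line (G : geometry) (q : nat) (u : point G) :
    unique_join G -> 1 < q -> #|point G| = q ^ 2 ->
    (forall X : line G, #|points_of X| <= q.+1) -> #|lines_of u| <= q ->
  #|lines_of u| = q /\
  exists U : line G, [/\ inc u U, #|points_of U| = q
    & forall X, X != U -> inc u X -> #|points_of X| = q.+1].
Proof.
move=> joinG q_gt1 card_point le_line le_u.
(* Each line through [u] has at most [q] further points. At most [q] lines must cover [q ^ 2 - 1]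
   points, so there are exactly [q] lines and the total shortfall is 1. *)
have deficit : \sum_(X in lines_of u) (q.+1 - #|points_of X|) + (q ^ 2).-1
    = #|lines_of u| * q.
  rewrite -card_point -(sum_card_lines_pred joinG u) -big_split /=.
  rewrite -sum_nat_const; apply: eq_bigr => X; rewrite inE => uX.
  by have := le_line X; rewrite (cardsD1 u) inE uX; lia.
have card_u : #|lines_of u| = q by rewrite -mulnn in deficit; nia.
split=> //.
have /eqP/sum_nat_eq1[U [uU dU dX]] :
    \sum_(X in lines_of u) (q.+1 - #|points_of X|) = 1.
  by rewrite card_u in deficit; nia.
exists U; split=> [||X neq uX]; first by rewrite inE in uU.
  by have := le_line U; lia.
by have := dX X neq; rewrite inE uX => /(_ isT); have := le_line X; lia.
Qed.

Section ShortLine.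

Variables (G : geometry) (q : nat) (u : point G) (U : line G).
Hypotheses (q_gt2 : 2 < q) (linearG : linear_space G).
Hypotheses (card_point : #|point G| = q ^ 2) (card_u : #|lines_of u| = q).
Hypotheses (le_lines : forall p : point G, #|lines_of p| <= q.+1).
Hypotheses (uU : inc u U) (card_U : #|points_of U| = q).
Hypotheses (card_long :
  forall X, X != U -> inc u X -> #|points_of X| = q.+1).
Implicit Types (p : point G) (X Y B : line G).

Let joinG : unique_join G := proj1 linearG.
Let A := exchange u U.

(** Some long line [E] through [u] misses [p], and its [q.+1] points are joined to [p] by distinct
    lines. *)
Lemma card_lines_neq p : p != u -> #|lines_of p| = q.+1.
Proof.
move=> neq; apply/eqP; rewrite eqn_leq le_lines /=.
(* Here [2 < q] enters: it provides two long lines through [u], and [p] lies on at most one of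
   them. *)
have /card_gt1P[B [C [uB uC neqBC]]] : 1 < #|lines_of u :\ U|.
  by have := cardsD1 U (lines_of u); rewrite card_u inE uU; lia.
rewrite !inE in uB uC; have [/andP[BU {}uB] /andP[CU {}uC]] := (uB, uC).
have [E [EU uE pE]] : exists E, [/\ E != U, inc u E & ~~ inc p E].
  have [pB|] := boolP (inc p B); last by exists B.
  exists C; split=> //; apply: contra_neqN neqBC => pC.
  exact: (eq_join joinG neq).
rewrite -(card_long EU uE) -(card_meeting joinG pE).
by apply: subset_leq_card; apply/subsetP => X; rewrite !inE => /andP[].
Qed.

(** For [p] on [X] but off [B], the [q.+1] points of [B] use up all [q.+1] lines through [p],
    including [X]. *)
Lemma meet_long X B : B != U -> inc u B -> meet X B.
Proof.
move=> BU uB; have [uX|uX] := boolP (inc u X); first by apply/meetP; exists u.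
have /card_gt0P[p] : 0 < #|points_of X| := ltnW (proj2 linearG X).
rewrite inE => pX; have [pB|pB] := boolP (inc p B).
  by apply/meetP; exists p.
have neq : p != u by apply: contraNneq uX => <-.
have /eqP := card_missing joinG pB.
rewrite card_lines_neq // card_long // subnn cards_eq0 => /eqP/setP/(_ X).
by rewrite !inE pX => /negbFE.
Qed.

(** The points of [X] correspond to the lines through [u] meeting it: all [q - 1] long ones, and
    possibly [U]. *)
Lemma card_points_off X : ~~ inc u X -> #|points_of X| = q - 1 + meet X U.
Proof.
move=> uX; rewrite -(card_meeting joinG uX) (cardsD1 U) !inE uU addnC meetC.
congr (_ + _); have := cardsD1 U (lines_of u); rewrite card_u inE uU.
move=> ->; rewrite addKn; apply: eq_card => Y; rewrite !inE.
case: eqP => //= /eqP YU; case uY: (inc u Y) => //=.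
by rewrite meetC meet_long.
Qed.

(** * The exchanged geometry as an affine plane *)

Lemma exchange_inc p X : p != u -> @inc A p X = inc p X.
Proof. by rewrite /= => /negbTE->. Qed.

(** For [p] off [U], [q] of the [q.+1] lines through [p] meet [U]; the remaining one receives the
    added point. *)
Lemma exchange_join_u p : p != u ->
  exists! X : line A, @inc A u X /\ @inc A p X.
Proof.
move=> neq; rewrite /= eqxx (negbTE neq); have [pU|pU] := boolP (inc p U).
  exists U; split=> [|X [parXU pX]]; first by rewrite /parallel eqxx.
  by rewrite (parallel_eq parXU pX pU).
have := card_missing joinG pU; rewrite card_lines_neq // card_U subSnn.
move=> /eqP/cards1P[Y missY].
have missE Z : (Z == Y) = inc p Z && ~~ meet Z U.
  by have /setP/(_ Z) := missY; rewrite !inE => ->.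
have := missE Y; rewrite eqxx => /esym/andP[pY YU].
exists Y; split=> [|Z [/orP[/eqP ZU|ZU] pZ]].
    by rewrite /parallel YU orbT.
  by rewrite -ZU pZ in pU.
by symmetry; apply/eqP; rewrite missE pZ.
Qed.

Lemma exchange_join : unique_join A.
Proof.
move=> p r neq; have [pu|pu] := eqVneq p u.
  by rewrite pu; apply: exchange_join_u; rewrite -pu eq_sym.
have [ru|ru] := eqVneq r u.
  rewrite ru; have [X [[uX pX] uniqX]] := exchange_join_u pu.
  by exists X; split=> [//|Y [pY uY]]; apply: uniqX.
by rewrite /= (negbTE pu) (negbTE ru); apply: joinG.
Qed.

(** [U] loses one point and gains one, a long line through [u] only loses one, and a line off [u]
    gains one exactly when it is disjoint from [U]. *)
Lemma card_exchange X : #|@points_of A X| = q.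
Proof.
have -> : #|@points_of A X| = parallel X U + #|points_of X :\ u|.
  rewrite [LHS](cardsD1 (u : point A)) inE /= eqxx; congr (_ + _).
  apply: eq_card => p.
  by rewrite !inE /=; case: eqP.
have := cardsD1 u (points_of X); rewrite inE /parallel.
have [->|XU] := eqVneq X U; first by rewrite uU card_U.
have [uX|uX] := boolP (inc u X).
  rewrite card_long // (_ : meet X U); first by rewrite /=; lia.
  by apply/meetP; exists u.
by rewrite card_points_off //; case: (meet X U) => /=; lia.
Qed.

(** A long line through [u] shares only [u] with [U], so removing [u] makes the two disjoint. A line
    off [u] either meets [U] in an old point or acquires the added point, which is on [U]. *)
Lemma exchange_direction X :
  (@direction A X == @direction A U) = inc u X.
Proof.
have q_gt1 : 1 < q by exact: ltnW.
rewrite (eq_direction exchange_join q_gt1 card_point card_exchange).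
have uAU : @inc A u U by rewrite /= eqxx /parallel eqxx.
have [uX|uX] := boolP (inc u X).
  have [->|XU] := eqVneq X U; first by rewrite /parallel eqxx.
  rewrite /parallel; apply/orP; right; apply/existsPn => p /=.
  case: eqP => [_|/eqP pu].
    have uXU : meet X U by apply/meetP; exists u.
    by rewrite /parallel (negbTE XU) uXU.
  by apply: contra XU => /andP[pX pU]; apply/eqP/(eq_join joinG pu).
apply/negP => parXU.
have XU : X != U by apply: contraNneq uX => ->.
case/orP: parXU => [|/existsPn missXU]; first by rewrite (negbTE XU).
have [/meetP[p [pX pU]]|mXU] := boolP (meet X U).
  have pu : p != u by apply: contraNneq uX => <-.
  by have := missXU p; rewrite !exchange_inc // pX pU.
by have := missXU u; rewrite uAU /= eqxx /parallel mXU orbT.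
Qed.

(** * Isomorphism with the deleted projective plane *)

Let P := completion A.
Let W : line P := None.
(** The original [u] returns as the ideal point of the class of [U], while the name [u] in [A]
    denotes the added point, which becomes [v]. *)
Let u' : point P := inr (@direction A U).
Let v : point P := inl (u : point A).

Definition exchange_embed p : point P :=
  if p == u then u' else inl (p : point A).

Lemma exchange_embed_notin p :
  exchange_embed p \notin v |: (points_of W :\ u').
Proof.
rewrite /exchange_embed; case: eqVneq => [_|neq]; rewrite !inE ?eqxx //=.
by rewrite orbF (inj_eq inl_inj).
Qed.

Definition exchange_point p : point (plane_deletion W u' v) :=
  exist _ (exchange_embed p) (exchange_embed_notin p).

Lemma exchange_line_notin X : (Some X : line P) \notin [set W].
Proof. by rewrite inE. Qed.

Definition exchange_line X : line (plane_deletion W u' v) :=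
  exist _ (Some X) (exchange_line_notin X).

Lemma exchange_isomorphism : isomorphism exchange_point exchange_line.
Proof.
split.
(* The only ideal point that survives the deletion is [u'], so every ideal point may be sent to
   [u]. *)
- exists (fun x => if val x is inl p then p else u).
    by move=> p /=; rewrite /exchange_embed; case: eqVneq.
  move=> [[p|c] notin]; apply: val_inj => /=; rewrite /exchange_embed.
    case: eqVneq => // pu.
    by move: notin; rewrite pu !inE eqxx.
  by rewrite eqxx; move: notin; rewrite !inE /= andbT negbK => /eqP.
(* The default [U] is never reached, since [None] is the deleted line [W]. *)
- exists (fun L => odflt U (val L)) => // -[[X|] notin].
    exact: val_inj.
  by exfalso; move: notin; rewrite inE eqxx.
move=> p X /=; rewrite /exchange_embed.
case: eqVneq => [->|neq] /=; first exact: exchange_direction.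
by rewrite (negbTE neq).
Qed.

End ShortLine.

Theorem theorem1p6 (D : geometry) (q : nat) (u : point D)
  (* The literal range is 1 < q; the case q = 2 has a counterexample, the
     linear space on four points with one line of three points: there three
     points are on two lines, so the conclusion on lines_of p fails. *)
  (q_gt2 : 2 < q)
  (D_linear : linear_space D)
  (D_card : #|point D| = q ^ 2)
  (D_lines : forall p : point D, #|lines_of p| <= q.+1)
  (D_points : forall X : line D, #|points_of X| <= q.+1)
  (u_lines : #|lines_of u| <= q) :
  (exists (P : geometry) (W : line P) (u' v : point P)
          (f : point D -> point (plane_deletion W u' v))
          (g : line D -> line (plane_deletion W u' v)),
     [/\ projective_plane_of_order P q,
         inc u' W /\ ~~ inc v W,
         isomorphism f g /\ val (f u) = u'
       & [/\ forall L : line P, inc u' L -> inc v L ->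
               #|[set p : point D | inc (val (f p)) L]| = q,
             forall X : line D, inc u X -> ~~ inc v (val (g X)) ->
               #|points_of X| = q.+1,
             forall L : line P, inc v L -> ~~ inc u' L ->
               #|[set p : point D | inc (val (f p)) L]| = q - 1
           & forall X : line D, ~~ inc u X -> ~~ inc v (val (g X)) ->
               #|points_of X| = q]]) /\
  (#|lines_of u| = q /\ forall p : point D, p != u -> #|lines_of p| = q.+1).
Proof.
have q_gt1 : 1 < q by lia.
have [card_u [U [uU card_U card_long]]] :=
  exists_short_line (proj1 D_linear) q_gt1 D_card D_points u_lines.
split; last first.
  by split=> // p; apply: card_lines_neq card_long _.
have card_off X : ~~ inc u X -> #|points_of X| = q - 1 + meet X U.
  exact: card_points_off card_long X.
have meet_u X : inc u X -> meet X U by move=> uX; apply/meetP; exists u.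
pose A := exchange u U; pose P := completion A.
pose W : line P := None; pose u' : point P := inr (@direction A U).
pose v : point P := inl (u : point A).
have iso : isomorphism (exchange_point u U) (exchange_line u U).
  exact: exchange_isomorphism card_long.
have joinA : unique_join A by exact: exchange_join card_long.
have card_A : forall X : line A, #|points_of X| = q.
  exact: card_exchange card_long.
have inc_u' (X : line D) : inc u' (Some X : line P) = inc u X.
  exact: exchange_direction card_long X.
have inc_v (X : line D) : inc v (Some X : line P) = parallel X U.
  by rewrite /= eqxx.
have card_set (X : line D) :
    #|[set p | inc (val (exchange_point u U p)) (Some X : line P)]| =
    #|points_of X|.
  by apply: eq_card => p; rewrite !inE; have [_ _ <-] := iso.
exists P, W, u', v, (exchange_point u U), (exchange_line u U); split=> //.
- exact: completion_projective joinA q_gt1 D_card card_A.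
- by split=> //=; rewrite /exchange_embed eqxx.
(* The case [None] is void because [v] is not on [W]. The lines through [v] are [U] and those
   disjoint from [U]; a line through [u] meets [U], so the join of [u'] and [v] is [U]. Off [u], the
   size depends on whether [X] meets [U]. *)
split=> [[X|] //|X uX|[X|] // |X uX];
  rewrite ?inc_u' ?inc_v ?card_set /parallel.
- by move=> uX /orP[/eqP->//|]; rewrite meet_u.
- by rewrite negb_or => /andP[XU _]; apply: card_long.
- move=> parXU uX; rewrite card_off //.
  have XU : X != U by apply: contraNneq uX => ->.
  by case/orP: parXU => [|/negbTE->]; rewrite ?(negbTE XU) ?addn0.
by rewrite negb_or negbK card_off // => /andP[_ ->] /=; lia.
Qed.
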